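(* Let $G$ be a twin-free, connected proper circular-arc graph on $n$ vertices whose complement is not bipartite. Let $\mathcal{H}'$ be the hypergraph on $V(G)$ obtained from $\mathcal{N}[G]$ by removing all hyperedges of size $n-1$. Then $\mathcal{H}'$ is twin-free and strictly overlap-connected.
   Context: Vertices $u\ne v$ of $G$ are twins if $N[u]=N[v]$. $\mathcal{N}[G]$ is the hypergraph on $V=V(G)$ with hyperedges the closed neighborhoods $N[v]$. A PCA graph is one having a representation by arcs of a circle, adjacency meaning intersection, in which no arc is contained in another. In a hypergraph, two distinct vertices are twins if every hyperedge contains both or neither. Sets $A,B\subseteq V$ strictly overlap if $A\cap B\neq\emptyset$, neither contains the other, and $A\cup B\neq V$. A hypergraph on $V$ is strictly overlap-connected if every vertex lies in some hyperedge and the graph on the hyperedges with adjacency meaning strict overlap is connected. *)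

(* Defs.v *)
(* set0 and setT below must denote the finset versions, hence this order. *)
From mathcomp Require Import classical_sets reals.
From mathcomp Require Import all_boot all_order all_algebra.

Set Implicit Arguments.
Unset Strict Implicit.
Unset Printing Implicit Defensive.

(* A graph on a finite vertex type V is its adjacency relation e : rel V. *)
Definition simple_graph (V : finType) (e : rel V) : Prop :=
  symmetric e /\ irreflexive e.

Definition connected_graph (V : finType) (e : rel V) : Prop :=
  0 < #|V| /\ forall u v : V, connect e u v.

Definition complement_graph (V : finType) (e : rel V) : rel V :=
  [rel u v | (u != v) && ~~ e u v].

Definition bipartite (V : finType) (e : rel V) : Prop :=
  exists A : {set V}, forall u v : V, e u v -> (u \in A) != (v \in A).

Definition closed_nbh (V : finType) (e : rel V) (v : V) : {set V} :=
  [set u | (u == v) || e v u].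

Definition twin_free_graph (V : finType) (e : rel V) : Prop :=
  forall u v : V, u != v -> closed_nbh e u <> closed_nbh e v.

Section CircularArcs.
Local Open Scope ring_scope.
Local Open Scope classical_set_scope.

(* The circle is R / Z, and its subsets are represented by the Z-periodic
   subsets of R: [circle_arc a b] is the preimage in R of the image of the
   closed interval [a, b] in R / Z. *)
Definition circle_arc (R : realType) (a b : R) : set R :=
  [set x : R | exists k : int, a <= x + k%:~R <= b].

Definition is_circle_arc (R : realType) (A : set R) : Prop :=
  exists a b : R, a <= b /\ A = circle_arc a b.

Definition proper_circular_arc_graph (R : realType) (V : finType) (e : rel V) :
    Prop :=
  exists alpha : V -> set R,
    [/\ forall v : V, is_circle_arc (alpha v),
        forall u v : V, u != v -> (e u v <-> alpha u `&` alpha v !=set0)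
      & forall u v : V, u != v -> ~ (alpha u `<=` alpha v)].

End CircularArcs.

(* A hypergraph on V is its set of hyperedges H : {set {set V}}. *)
Definition nbh_hypergraph (V : finType) (e : rel V) : {set {set V}} :=
  [set closed_nbh e v | v : V].

Definition remove_hyperedges_of_size (V : finType) (H : {set {set V}})
    (k : nat) : {set {set V}} :=
  [set A in H | #|A| != k].

Definition hypergraph_twins (V : finType) (H : {set {set V}}) (u v : V) : Prop :=
  u != v /\ forall A : {set V}, A \in H -> (u \in A) = (v \in A).

Definition twin_free_hypergraph (V : finType) (H : {set {set V}}) : Prop :=
  forall u v : V, ~ hypergraph_twins H u v.

Definition strictly_overlap (V : finType) (A B : {set V}) : bool :=
  [&& A :&: B != set0, ~~ (A \subset B), ~~ (B \subset A) & A :|: B != setT].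

Definition strictly_overlap_connected (V : finType) (H : {set {set V}}) : Prop :=
  (forall v : V, exists2 A : {set V}, A \in H & v \in A) /\
  connected_graph
    (fun A B : {A : {set V} | A \in H} => strictly_overlap (val A) (val B)).

(* Main.v *)
Require Import Defs.
From mathcomp Require Import reals.
From mathcomp Require Import all_boot all_order all_algebra.

(** No arc of a proper model is contained in the arc of [x], so every arc meeting
    it contains one of its two endpoints.  Hence the complement [f] of the graph
    induces a bipartite graph on each closed neighbourhood [N[x]]; this is the
    only consequence of the arc representation that is needed.

    Strict overlap of [A] and [B] means that the bipartitions [{A, ~: A}] and
    [{B, ~: B}] cross, so it is insensitive to complementation, and [N[v]] may be
    replaced by the neighbourhood of [v] in [f].  If the strict overlap graph is
    disconnected, the members of one component do not separate some side of a
    hyperedge outside it, and a class [Y] of vertices not separated by that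
    component yields a bipartition [{Y, ~: Y}] with two nontrivial parts that
    crosses no hyperedge.  Then each neighbourhood in [f] is contained in a part
    or contains a part, and in every case 2-colourings of [f] on closed
    neighbourhoods can be glued to a 2-colouring of [f]. *)

Set Implicit Arguments.
Unset Strict Implicit.
Unset Printing Implicit Defensive.

(** * Strict overlap and complementation *)

Lemma strictly_overlapC (V : finType) (A B : {set V}) :
  strictly_overlap A B = strictly_overlap B A.
Proof. by rewrite /strictly_overlap setIC setUC; congr (_ && _); rewrite andbCA. Qed.

Lemma strictly_overlapP (V : finType) (A B : {set V}) :
  reflect [/\ exists2 x, x \in A & x \in B, exists2 x, x \in A & x \notin B,
              exists2 x, x \notin A & x \in B & exists2 x, x \notin A & x \notin B]
          (strictly_overlap A B).
Proof.
apply: (iffP and4P) => -[h1 h2 h3 h4]; split.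
- by have [x /setIP[]] := set0Pn _ h1; exists x.
- by have [x ? ?] := subsetPn h2; exists x.
- by have [x ? ?] := subsetPn h3; exists x.
- by have := h4; rewrite -subTset => /subsetPn[x _]; rewrite !inE negb_or;
    case/andP; exists x.
- by have [x xA xB] := h1; apply/set0Pn; exists x; rewrite inE xA.
- by have [x xA xB] := h2; apply/subsetPn; exists x.
- by have [x xA xB] := h3; apply/subsetPn; exists x.
- have [x xA xB] := h4; rewrite -subTset; apply/subsetPn; exists x => //.
  by rewrite !inE negb_or xA.
Qed.

Lemma strictly_overlap_setC (V : finType) (A B : {set V}) :
  strictly_overlap (~: A) B = strictly_overlap A B.
Proof.
apply/strictly_overlapP/strictly_overlapP => -[[x] + + [y] + + [z] + + [t]];
  rewrite ?inE ?negbK => *;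
  (split; [exists z|exists t|exists x|exists y]); by rewrite ?inE ?negbK.
Qed.

Lemma strictly_overlapN (V : finType) (A B : {set V}) :
  ~~ strictly_overlap A B ->
  [\/ [disjoint A & B], A \subset B, B \subset A | ~: A \subset B].
Proof.
rewrite /strictly_overlap !negb_and !negbK => /or4P[h|h|h|h].
- by constructor 1; rewrite -setI_eq0.
- by constructor 2.
- by constructor 3.
- constructor 4; apply/subsetP => x; rewrite inE => xA.
  by have := in_setT x; rewrite -(eqP h) inE (negbTE xA).
Qed.

Definition unseparated (V : finType) (D A : {set V}) : bool :=
  (D \subset A) || (D \subset ~: A).

Lemma unseparatedP (V : finType) (D A : {set V}) :
  reflect {in D &, forall u v, (u \in A) = (v \in A)} (unseparated D A).
Proof.
apply: (iffP orP) => [[/subsetP h|/subsetP h] u v uD vD|h].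
- by rewrite !h.
- by have := h u uD; have := h v vD; rewrite !inE => /negbTE-> /negbTE->.
- have [->|[d dD]] := set_0Vmem D; first by left; apply: sub0set.
  case: (boolP (d \in A)) => dA; [left|right]; apply/subsetP => u uD.
    by rewrite (h u d).
  by rewrite inE (h u d).
Qed.

Lemma unseparated_overlapN (V : finType) (A B : {set V}) :
  ~~ strictly_overlap A B -> unseparated A B || unseparated (~: A) B.
Proof.
move=> /strictly_overlapN[h|h|h|h]; rewrite /unseparated.
- by rewrite -disjoints_subset h orbT.
- by rewrite h.
- by rewrite setCS h !orbT.
- by rewrite h !orbT.
Qed.

(** Since [D] and [B] do not overlap, [D] or [~: D] lies on one side of [B]. The second is
    impossible: [D] lies on one side of [A], so [~: D] contains the other side, which meets both
    sides of [B]. *)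
Lemma unseparated_overlap (V : finType) (D A B : {set V}) :
  strictly_overlap A B -> ~~ strictly_overlap D B -> unseparated D A -> unseparated D B.
Proof.
move=> /strictly_overlapP[[x xA xB] [y yA yB] [z zA zB] [t tA tB]].
move=> /unseparated_overlapN/orP[//|/unseparatedP uB /unseparatedP uA].
apply/unseparatedP => u v uD vD; apply/eqP/negPn/negP => uvB.
have sameA w : w \in D -> (w \in A) = (u \in A) by move=> wD; apply: uA.
case: (boolP (u \in A)) => uAb.
- have zD : z \in ~: D by rewrite inE; apply/negP => /sameA; rewrite (negbTE zA) uAb.
  have tD : t \in ~: D by rewrite inE; apply/negP => /sameA; rewrite (negbTE tA) uAb.
  by have := uB z t zD tD; rewrite zB (negbTE tB).
- have xD : x \in ~: D by rewrite inE; apply/negP => /sameA; rewrite xA (negbTE uAb).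
  have yD : y \in ~: D by rewrite inE; apply/negP => /sameA; rewrite yA (negbTE uAb).
  by have := uB x y xD yD; rewrite xB (negbTE yB).
Qed.

(** * Arcs of the circle *)

Section Arcs.
Import Order.TTheory GRing.Theory Num.Theory.
Local Open Scope ring_scope.

(** Translate [[a, b]] so that it contains the lift of [p] in [[c, d]]. The lift of [q] in [[c, d]]
    lies outside it, so an endpoint falls between the two lifts. *)
Lemma circle_arc_endpoint (R : realType) (a b c d p q : R) :
  circle_arc a b p -> circle_arc c d p -> ~ circle_arc a b q ->
  circle_arc c d q -> circle_arc c d a \/ circle_arc c d b.
Proof.
move=> [l /andP[pa pb]] [k /andP[pc pd]] nq [m /andP[qc qd]].
have sh (x : R) : x + (k - l)%:~R = x - l%:~R + k%:~R by rewrite intrB addrCA addrC.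
have [qa|qa] := ltP (q + m%:~R) (a + (k - l)%:~R).
  left; exists (k - l); rewrite (le_trans qc (ltW qa)) /=.
  by apply: le_trans pd; rewrite sh lerD2r lerBlDr.
have [qb|qb] := ltP (b + (k - l)%:~R) (q + m%:~R).
  right; exists (k - l); rewrite (le_trans _ (le_trans (ltW qb) qd)) ?andbT //.
  by apply: (le_trans pc); rewrite sh lerD2r lerBrDr.
case: nq; exists (m - (k - l)); rewrite intrB addrA.
by rewrite lerBrDr qa lerBlDr.
Qed.

Lemma proper_circular_arc_nbh_bipartite (R : realType) (V : finType)
    (e : rel V) (x : V) :
  proper_circular_arc_graph R e ->
  exists A : {set V}, forall u v : V,
    u \in closed_nbh e x -> v \in closed_nbh e x ->
    complement_graph e u v -> (u \in A) != (v \in A).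
Proof.
move=> [al [alc ale aln]].
have [a [b [ab ax]]] := alc x.
have end_in u : u \in closed_nbh e x -> al u a \/ al u b.
  rewrite inE; have [-> _|ux /= xu] := eqVneq u x.
    by left; rewrite ax; exists 0; rewrite addr0 lexx ab.
  have xu' : x != u by rewrite eq_sym.
  have [p [px pu]] := (ale _ _ xu').1 xu.
  have [q qu qx] : exists2 q, al u q & ~ al x q.
    by apply: boolp.contrapT => h; apply: (aln u x ux) => q qu;
      apply: boolp.contrapT => qx; apply: h; exists q.
  have [c [d [cd acd]]] := alc u.
  move: px pu qu qx; rewrite ax acd => *.
  exact: (@circle_arc_endpoint _ a b c d p q).
(* Arcs of equal colour both contain [a] or both contain [b], so they meet. *)
exists [set u | boolp.asbool (al u a)] => u v uN vN /= /andP[uv].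
rewrite !inE; apply: contraNneq => eq_uv; apply/(ale _ _ uv).
case: (boolP (boolp.asbool (al u a))) (eq_uv) => /boolp.asboolP ha.
  by move/esym/boolp.asboolP; exists a.
move/esym/negbT/boolp.asboolP => hb; exists b.
by split; [case: (end_in _ uN)|case: (end_in _ vN)].
Qed.

End Arcs.

(** * Graphs that are 2-colourable off each neighbourhood *)

(** Here [f] stands for the complement graph: [~~ f x u] says that [u] is in the closed
    neighbourhood of [x]. *)
Definition locally_bipartite (V : finType) (f : rel V) : Prop :=
  forall x : V, exists A : {set V}, forall u v : V,
    ~~ f x u -> ~~ f x v -> f u v -> (u \in A) != (v \in A).

Definition nbr (V : finType) (f : rel V) (v : V) : {set V} := [set u | f v u].

Section LocallyBipartite.
Variables (V : finType) (f : rel V).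

Lemma locally_bipartite_no_isolated :
  locally_bipartite f -> ~ bipartite f -> forall x, exists y, f x y.
Proof.
move=> loc nbip x; apply/existsP; apply: contraT; rewrite negb_exists => /forallP fx.
by case: nbip; have [A cA] := loc x; exists A => u v; apply: cA.
Qed.

(* Otherwise every vertex [x] separating [u] from [v] has degree one.  If such
   an [x] is adjacent to [v], a 2-colouring of [f] away from [v] extends to [v]
   by giving it the colour of [u]. *)
Lemma locally_bipartite_separating (u v : V) :
  symmetric f -> irreflexive f -> locally_bipartite f -> ~ bipartite f ->
  u != v ->
  (exists x, f x u != f x v) ->
  exists2 x, f x u != f x v & 1 < #|nbr f x|.
Proof.
move=> fsym firr loc nbip.
have sep w z : w != z -> (exists2 p, f p z & ~~ f p w) ->
    exists2 x, f x w != f x z & 1 < #|nbr f x|.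
  move=> wz [p pz pw].
  have [/exists_inP[x xs xd]|] :=
    boolP [exists (x | f x w != f x z), 1 < #|nbr f x|]; first by exists x.
  rewrite negb_exists_in => /forall_inP deg1.
  have pend x b : f x z -> ~~ f x w -> f x b -> b = z.
    move=> xz xw xb; have := deg1 x; rewrite xz (negbTE xw) -leqNgt => /(_ isT).
    by move=> /card_le1_eqP; apply; rewrite inE.
  have [A cA] := loc p; case: nbip.
  have neqA a b : a != z -> b != z -> f a b -> (a \in A) != (b \in A).
    by move=> az bz; apply: cA; [apply: contra az|apply: contra bz];
      move=> /(pend _ _ pz pw)->.
  (* [A] is proper off [z], the only neighbour of [p]. Common neighbours of [z] and [w] already
     differ from [w]; the other neighbours of [z] have degree one and can be recoloured. *)
  exists [set y | if y == z then w \in A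
                 else if f y z && ~~ f y w then w \notin A else y \in A].
  have colz b : f z b -> b != z ->
      (w \in A) != (if f b z && ~~ f b w then w \notin A else b \in A).
    move=> zb bz; rewrite fsym zb /=; case: ifPn => [_|]; first by case: (w \in A).
    by rewrite negbK fsym => wb; apply: neqA.
  move=> a b ab; rewrite !inE.
  have [az|az] := eqVneq a z; have [bz|bz] := eqVneq b z.
  - by move: ab; rewrite az bz firr.
  - by apply: colz; rewrite // -az.
  - by rewrite eq_sym; apply: colz; rewrite // -bz fsym.
  - case: ifP => [/andP[h h']|_]; first by rewrite (pend _ _ h h' ab) eqxx in bz.
    case: ifP => [/andP[h h']|_]; last exact: neqA.
    by move: az; rewrite (pend b a) ?eqxx // fsym.
move=> uv [x]; case fu: (f x u); case fv: (f x v) => // _.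
  have [||y yuv ?] := sep v u; [by rewrite eq_sym|by exists x; rewrite ?fv|].
  by exists y; rewrite // eq_sym.
by apply: sep => //; exists x; rewrite ?fu.
Qed.

(** The remaining case, [Z] inside the neighbourhood of [v], would make [v] its own neighbour. *)
Lemma nbr_noncrossing (Z : {set V}) (v : V) :
  irreflexive f -> ~~ strictly_overlap (nbr f v) Z -> v \in Z ->
  [\/ forall w, f v w -> w \in Z, forall w, f v w -> w \notin Z
    | forall w, w \notin Z -> f v w].
Proof.
move=> firr /strictly_overlapN[h|h|h|h] vZ.
- constructor 2 => w vw; apply/negP => wZ.
  by move: h; rewrite disjoints_subset => /subsetP/(_ w); rewrite !inE vw wZ => /(_ isT).
- by constructor 1 => w vw; apply: (subsetP h); rewrite inE.
- by have := subsetP h v vZ; rewrite inE firr.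
- constructor 3 => w; apply: contraNT => vw.
  by apply: (subsetP h); rewrite !inE.
Qed.

(* If [Z] were independent, some [y] outside [Z] would have its neighbourhood
   properly inside [Z].  A 2-colouring of [f] away from this neighbourhood
   extends: [Z] gets one colour, and the vertices with all neighbours in [Z]
   get the other. *)
Lemma noncrossing_split_not_independent (Z : {set V}) :
  symmetric f -> irreflexive f -> locally_bipartite f -> ~ bipartite f ->
  (forall u v, u != v -> exists x, f x u != f x v) ->
  1 < #|Z| ->
  (forall v, ~~ strictly_overlap (nbr f v) Z) ->
  exists2 u, u \in Z & exists2 v, v \in Z & f u v.
Proof.
move=> fsym firr loc nbip sep /card_gt1P[z1 [z2 [z1Z z2Z z12]]] ncr.
have [/exists_inP[u uZ /exists_inP[v vZ uv]]|] :=
  boolP [exists u in Z, exists v in Z, f u v]; first by exists u => //; exists v.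
move=> /exists_inPn ind'.
have {}ind u v : u \in Z -> v \in Z -> f u v = false.
  by move=> uZ vZ; apply/negbTE/(exists_inPn (ind' u uZ)).
have type_out y : y \notin Z -> [\/ forall w, f y w -> w \in Z,
    forall w, f y w -> w \notin Z | forall w, w \in Z -> f y w].
  move=> yZ; case: (@nbr_noncrossing (~: Z) y) => //.
  - by rewrite strictly_overlapC strictly_overlap_setC strictly_overlapC.
  - by rewrite inE.
  - by move=> h; constructor 2 => w /h; rewrite inE.
  - by move=> h; constructor 1 => w /h; rewrite inE negbK.
  - by move=> h; constructor 3 => w wZ; apply: h; rewrite inE negbK.
have [y ysep] := sep _ _ z12.
have yZ : y \notin Z by apply: contraNN ysep => yZ; rewrite !ind.
have [z zZ yz] : exists2 z, z \in Z & ~~ f y z.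
  by move: ysep; case h1: (f y z1); case h2: (f y z2) => // _;
    [exists z2|exists z1]; rewrite ?h1 ?h2.
(* As [y] separates [z1] from [z2], its neighbourhood meets [Z] without containing it. *)
have yin w : f y w -> w \in Z.
  move: w; case: (type_out y yZ) => // h.
    move: ysep; case h1: (f y z1); case h2: (f y z2) => // _.
      by have := h _ h1; rewrite z1Z.
    by have := h _ h2; rewrite z2Z.
  by rewrite !h in ysep.
have [A cA] := loc y; case: nbip.
pose inner u := [forall w, f u w ==> (w \in Z)].
exists [set u | if u \in Z then z \in A
               else if inner u then z \notin A else u \in A].
have colZ u v : u \in Z -> v \notin Z -> f u v ->
    (z \in A) != (if inner v then z \notin A else v \in A).
  move=> uZ vZ uv; case: ifPn => [_|/negP vin]; first by case: (z \in A).
  (* With a neighbour [u] in [Z] and another outside, [v] is adjacent to all of [Z]. Neither [z] nor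
     [v] is a neighbour of [y], so [A] separates them. *)
  have zv : f z v.
    rewrite fsym; case: (type_out v vZ) => [h|h|h]; last exact: h.
      by case: vin; apply/forallP => w; apply/implyP; apply: h.
    by have := h u; rewrite fsym uv uZ => /(_ isT).
  by apply: cA => //; apply: contra vZ; apply: yin.
move=> u v uv; rewrite !inE.
case: (boolP (u \in Z)) => uZ; case: (boolP (v \in Z)) => vZ.
- by rewrite ind in uv.
- exact: (colZ u v).
- by rewrite eq_sym; apply: (colZ v u) => //; rewrite fsym.
- case: ifPn => [/forallP/(_ v)|_]; first by rewrite uv (negbTE vZ).
  case: ifPn => [/forallP/(_ u)|_]; first by rewrite fsym uv (negbTE uZ).
  by apply: cA uv; [apply: contra uZ|apply: contra vZ]; apply: yin.
Qed.

(** Both parts contain an edge of [f]. An endpoint of an edge inside [Z] has all its neighbours in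
    [Z] or is adjacent to the whole other part; the proof splits on which holds for [z]. *)
Lemma no_noncrossing_split (Z : {set V}) :
  symmetric f -> irreflexive f -> locally_bipartite f -> ~ bipartite f ->
  (forall u v, u != v -> exists x, f x u != f x v) ->
  (exists2 u, u \in Z & exists2 v, v \notin Z & ~~ f u v) ->
  1 < #|Z| -> 1 < #|~: Z| ->
  ~ (forall v, ~~ strictly_overlap (nbr f v) Z).
Proof.
move=> fsym firr loc nbip sep [z1 z1Z [y1 y1Z z1y1]] cZ cY ncr.
have ncrC v : ~~ strictly_overlap (nbr f v) (~: Z).
  by rewrite strictly_overlapC strictly_overlap_setC strictly_overlapC.
have [z zZ [z' z'Z zz']] : exists2 u, u \in Z & exists2 v, v \in Z & f u v.
  exact: noncrossing_split_not_independent.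
have [y yY [y' y'Y yy']] :
    exists2 u, u \in ~: Z & exists2 v, v \in ~: Z & f u v.
  exact: noncrossing_split_not_independent.
have typeZ v := nbr_noncrossing firr (ncr v).
have typeY v : v \notin Z -> [\/ forall w, f v w -> w \notin Z,
    forall w, f v w -> w \in Z | forall w, w \in Z -> f v w].
  rewrite -in_setC => /(nbr_noncrossing firr (ncrC v))[] h.
  - by constructor 1 => w /h; rewrite inE.
  - by constructor 2 => w /h; rewrite inE negbK.
  - by constructor 3 => w wZ; apply: h; rewrite inE negbK.
move: yY y'Y; rewrite !inE => yY y'Y.
have zfull_or w w' : w \in Z -> w' \in Z -> f w w' ->
    (forall x, f w x -> x \in Z) \/ (forall x, x \notin Z -> f w x).
  move=> wZ w'Z ww'; case: (typeZ w wZ) => h; [by left| |by right].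
  by have := h _ ww'; rewrite w'Z.
have [zin|zfull] := zfull_or _ _ zZ z'Z zz'.
  (* Both parts are 2-colourable, being disjoint from the neighbourhoods of [y]
     and [z], and edges between them join vertices whose edges all go across. *)
- have yout w : f y w -> w \notin Z.
    move: w; case: (typeY y yY) => // h; first by have := h _ yy'; rewrite (negbTE y'Y).
    by have := h _ zZ; rewrite fsym => /zin; rewrite (negbTE yY).
  have [A cA] := loc z; have [B cB] := loc y; case: nbip.
  exists [set u |
    if u \in Z then if [forall w, f u w ==> (w \in Z)] then u \in B else true
    else if [forall w, f u w ==> (w \notin Z)] then u \in A else false].
  have innerZ u v : f u v -> u \in Z -> v \in Z -> [forall w, f u w ==> (w \in Z)].
    move=> uv uZ vZ; have [h|h] := zfull_or _ _ uZ vZ uv.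
      by apply/forallP => w; apply/implyP/h.
    by have := h y yY; rewrite fsym => /yout; rewrite uZ.
  have innerY u v : f u v -> u \notin Z -> v \notin Z ->
      [forall w, f u w ==> (w \notin Z)].
    move=> uv uZ vZ; have [h|h|h] := typeY u uZ.
    - by apply/forallP => w; apply/implyP/h.
    - by have := h _ uv; rewrite (negbTE vZ).
    - by have := h z zZ; rewrite fsym => /zin; rewrite (negbTE uZ).
  have cross u v : f u v -> u \in Z -> v \notin Z ->
      (if [forall w, f u w ==> (w \in Z)] then u \in B else true) !=
      (if [forall w, f v w ==> (w \notin Z)] then v \in A else false).
    move=> uv uZ vZ; case: ifPn => [/forallP/(_ v)|_]; first by rewrite uv (negbTE vZ).
    by case: ifPn => [/forallP/(_ u)|_]; first by rewrite fsym uv uZ.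
  move=> u v uv; have vu := uv; rewrite fsym in vu; rewrite !inE.
  case: (boolP (u \in Z)) => uZ; case: (boolP (v \in Z)) => vZ.
  + rewrite (innerZ u v) // (innerZ v u) //.
    by apply: cB uv; [apply: contraL uZ|apply: contraL vZ]; apply: yout.
  + exact: cross.
  + by rewrite eq_sym; apply: cross.
  + rewrite (innerY u v) // (innerY v u) //.
    by apply: cA uv; [apply: contra uZ|apply: contra vZ]; apply: zin.
  (* An edge of [f] inside [Z] forms with [y1] a triangle in [N[z1]]. *)
- have yfull w : w \in Z -> f y w.
    move: w; case: (typeY y yY) => // h.
      by have := h z; rewrite fsym zfull // zZ => /(_ isT).
    by have := h _ yy'; rewrite (negbTE y'Y).
  (* [z1] is adjacent to [y] but not to [y1], both outside [Z]. *)
  have z1out w : f z1 w -> w \notin Z.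
    move: w; case: (typeZ z1 z1Z) => // h.
      by have := h y; rewrite fsym yfull // (negbTE yY) => /(_ isT).
    by rewrite h in z1y1.
  have fullZ w w' : w \in Z -> w' \in Z -> f w w' -> f w y1.
    move=> wZ w'Z ww'; have [h|h] := zfull_or _ _ wZ w'Z ww'; last exact: h.
    by have := h y; rewrite fsym yfull // (negbTE yY) => /(_ isT).
  have z1N w : w \in Z -> ~~ f z1 w by apply: contraL => /z1out.
  have [A cA] := loc z1.
  have := cA z z' (z1N _ zZ) (z1N _ z'Z) zz'.
  have := cA z y1 (z1N _ zZ) z1y1 (fullZ _ _ zZ z'Z zz').
  have := cA z' y1 (z1N _ z'Z) z1y1.
  rewrite (fullZ z' z) // 1?fsym // => /(_ isT).
  by case: (z \in A); case: (z' \in A); case: (y1 \in A).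
Qed.

End LocallyBipartite.

(** * Disconnected strict overlap graphs *)

Lemma overlap_disconnected_split (V : finType) (H : {set {set V}})
    (a b : {A : {set V} | A \in H}) :
  {in H, forall A : {set V}, 1 < #|A| /\ 1 < #|~: A|} ->
  ~~ connect (fun A B : {A : {set V} | A \in H} =>
                strictly_overlap (val A) (val B)) a b ->
  exists Y : {set V},
    [/\ 1 < #|Y|, 1 < #|~: Y| & {in H, forall A : {set V}, ~~ strictly_overlap A Y}].
Proof.
set r := fun A B : {A : {set V} | A \in H} => _ => sz nab.
have rsym : symmetric r by move=> x y; apply: strictly_overlapC.
have side c : ~~ connect r a c ->
    exists2 D, D = val c \/ D = ~: val c &
      forall x, connect r a x -> unseparated D (val x).
  move=> nac.
  have nover x : connect r a x -> ~~ strictly_overlap (val c) (val x).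
    move=> ax; apply: contra nac => cx.
    by apply: (connect_trans ax); apply: connect1; rewrite rsym.
  have [D Dc Da] : exists2 D, D = val c \/ D = ~: val c & unseparated D (val a).
    have /orP[h|h] := unseparated_overlapN (nover a (connect0 _ _)).
      by exists (val c) => //; left.
    by exists (~: val c) => //; right.
  have nD x : connect r a x -> ~~ strictly_overlap D (val x).
    by move/nover; case: Dc => -> //; rewrite strictly_overlap_setC.
  have walk p : forall q, connect r a q -> unseparated D (val q) ->
      path r q p -> unseparated D (val (last q p)).
    elim: p => //= w p IH q aq Dq /andP[qw wp].
    have aw : connect r a w by apply: connect_trans aq (connect1 qw).
    by apply: IH => //; apply: unseparated_overlap qw (nD w aw) Dq.
  by exists D => // x /connectP[p ap ->]; apply: walk.
have [D Db Dsep] := side b nab.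
have cardD : 1 < #|D|.
  by have [h1 h2] := sz _ (valP b); case: Db => ->.
have [d [_ [dD _ _]]] := card_gt1P cardD.
(* The vertices that no member of the component of [a] separates from [d]. They include [D] and miss
   a whole side of [a], whence both cardinality bounds. *)
pose Y := [set v | [forall x, connect r a x ==> ((v \in val x) == (d \in val x))]].
have YP v : reflect (forall x, connect r a x -> (v \in val x) = (d \in val x)) (v \in Y).
  rewrite inE; apply: (iffP forallP) => h x; last by apply/implyP => /h/eqP.
  by move=> ax; apply/eqP/(implyP (h x)).
exists Y; split.
- apply: leq_trans cardD _; apply/subset_leq_card/subsetP => v vD.
  by apply/YP => x /Dsep/unseparatedP; apply.
- have [h1 h2] := sz _ (valP a).
  have aY v : v \in Y -> (v \in val a) = (d \in val a).
    by move/YP; apply; apply: connect0.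
  case: (boolP (d \in val a)) => da; [apply: leq_trans h2 _|apply: leq_trans h1 _];
    apply/subset_leq_card/subsetP => v; rewrite ?in_setC => va; apply/negP => /aY.
    by rewrite (negbTE va) da.
  by rewrite va (negbTE da).
- move=> C CH; pose c : {A : {set V} | A \in H} := exist _ C CH.
  case: (boolP (connect r a c)) => ac.
    apply/negP => /strictly_overlapP[[x xC /YP/(_ c ac) xY] _ [y yC /YP/(_ c ac)] yY _].
    by move: xY; rewrite -yY /= xC (negbTE yC).
  have [E Ec Esep] := side c ac.
  (* If [E] meets [Y], then [E] lies inside [Y], as the component does not separate [E]. *)
  suff : ~~ strictly_overlap E Y.
    by case: Ec => ->; rewrite ?strictly_overlap_setC.
  apply/negP => /strictly_overlapP[[x xE /YP xY] [y yE /negP yY] _ _]; apply: yY.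
  by apply/YP => w aw; rewrite -(xY w aw); apply: (unseparatedP _ _ (Esep w aw)).
Qed.

(** * Closed neighbourhoods as complements of neighbourhoods in [f] *)

Theorem theorem4p2 (R : realType) (V : finType) (e : rel V) :
  simple_graph e ->
  twin_free_graph e ->
  connected_graph e ->
  proper_circular_arc_graph R e ->
  ~ bipartite (complement_graph e) ->
  let H' := remove_hyperedges_of_size (nbh_hypergraph e) (#|V| - 1) in
  twin_free_hypergraph H' /\ strictly_overlap_connected H'.
Proof.
move=> [esym _] tf [V0 econ] pca nbip H'.
set f := complement_graph e in nbip.
have fE u v : f u v = (u != v) && ~~ e u v by [].
have fsym : symmetric f by move=> u v; rewrite !fE eq_sym esym.
have firr : irreflexive f by move=> u; rewrite fE eqxx.
have closedE v : closed_nbh e v = ~: nbr f v.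
  by apply/setP => u; rewrite !inE fE negb_and !negbK eq_sym.
have loc : locally_bipartite f.
  move=> x; have [A cA] := proper_circular_arc_nbh_bipartite x pca.
  by exists A => u v xu xv; apply: cA; rewrite closedE !inE.
have sep u v : u != v -> exists x, f x u != f x v.
  move=> uv; apply/existsP; apply: contraT; rewrite negb_exists => /forallP h.
  case: (tf u v uv); rewrite !closedE; apply/setP => x; rewrite !inE.
  by have := h x; rewrite negbK !(fsym x) => /eqP->.
have niso := locally_bipartite_no_isolated loc nbip.
have cut (Z : {set V}) u v : u \in Z -> v \notin Z ->
    exists2 x, x \in Z & exists2 y, y \notin Z & e x y.
  move=> uZ vZ.
  have [/exists_inP[x xZ /exists_inP[y yZ xy]]|/exists_inPn nex] :=
    boolP [exists x in Z, exists y in ~: Z, e x y].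
    by exists x => //; exists y; rewrite -?in_setC.
  have no_out x y : x \in Z -> e x y -> y \in Z.
    move=> xZ xy; apply: contraT => yZ.
    by have /exists_inPn/(_ y) := nex x xZ; rewrite inE yZ xy => /(_ isT).
  have clZ : closed e (mem Z).
    by move=> x y xy; apply/idP/idP => h; apply: no_out h _; rewrite // esym.
  by have := closed_connect clZ (econ u v); rewrite uZ (negbTE vZ).
(* Size [n - 1] means degree one in [f]; degree zero is excluded by [niso]. *)
have inH v : (closed_nbh e v \in H') = (1 < #|nbr f v|).
  have [w vw] := niso v.
  have n0 : 0 < #|nbr f v| by apply/card_gt0P; exists w; rewrite inE.
  have := cardsC (nbr f v); rewrite -closedE => cardE.
  rewrite inE imset_f //= -cardE; case: #|nbr f v| n0 => [|[|k]] //= _.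
    by rewrite add1n subn1 eqxx.
  by rewrite !addSn subn1 /= -addSn -{1}[#|_|]add0n eqn_add2r.
have H'P A : A \in H' -> exists v, A = closed_nbh e v.
  by rewrite inE => /andP[/imsetP[v _ ->] _]; exists v.
have sz : {in H', forall A : {set V}, 1 < #|A| /\ 1 < #|~: A|}.
  move=> A AH; have [v AE] := H'P A AH; move: AH; rewrite AE inH => cv.
  split; last by rewrite closedE setCK.
  have [w vw] := niso v.
  have [||x] := cut [set v] v w; rewrite ?inE //.
    by apply: contraTneq vw => ->; rewrite firr.
  move=> /eqP-> [y yv vy]; apply/card_gt1P; exists v, y.
  by rewrite !inE eqxx vy orbT; split=> //; rewrite eq_sym; move: yv; rewrite inE.
have tfH : twin_free_hypergraph H'.
  move=> u v [uv huv].
  have [x xuv cx] := locally_bipartite_separating fsym firr loc nbip uv (sep u v uv).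
  have := huv (closed_nbh e x); rewrite inH closedE !inE => /(_ cx).
  by move/negb_inj => h; rewrite h eqxx in xuv.
have cover w : exists2 A : {set V}, A \in H' & w \in A.
  have [/exists_inP[A AH wA]|/exists_inPn none] := boolP [exists A in H', w \in A].
    by exists A.
  (* If no hyperedge covers [w], then [w] has a unique neighbour [x] in [f], and every vertex other
     than [x] has degree at most one. So only [N[x]] can survive in [H'], and twin-freeness makes it
     a 2-colouring of [f]. *)
  have small v : f w v = false -> #|nbr f v| <= 1.
    move=> wv; rewrite leqNgt -inH; apply/negP => /none.
    by rewrite closedE !inE fsym wv.
  have [x wx] := niso w.
  have wN v : v != x -> f w v = false.
    apply: contra_neqF => wv; apply: (card_le1_eqP (small w (firr w)));
      by rewrite inE.
  case: nbip; exists (closed_nbh e x) => u v uv; apply/eqP => same.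
  apply: (tfH u v); split; first by apply: contraTneq uv => ->; rewrite firr.
  move=> A AH; have [y AE] := H'P A AH; move: AH; rewrite AE inH.
  by have [-> //|/wN/small] := eqVneq y x; rewrite leqNgt => /negbTE->.
split=> //; split=> //; split.
  have [w _] := card_gt0P V0; have [A AH _] := cover w.
  by apply/card_gt0P; exists (exist _ A AH).
move=> a b; apply: contraT => /(overlap_disconnected_split sz)[Y [cY cY' nov]].
have [u [_ [uY _ _]]] := card_gt1P cY; have [v [_ [vY _ _]]] := card_gt1P cY'.
case: (@no_noncrossing_split _ f Y) => //.
  have [|x xY [y yY xy]] := cut Y u v uY; first by rewrite -in_setC.
  by exists x => //; exists y; rewrite // fE xy andbF.
(* A removed hyperedge corresponds to a neighbourhood with at most one element, which crosses
   nothing. *)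
move=> w; have [cw|cw] := ltnP 1 #|nbr f w|.
  by rewrite -strictly_overlap_setC -closedE; apply: nov; rewrite inH.
apply/negP => /strictly_overlapP[[x xw xY] [y yw yY] _ _].
by move: yY; rewrite (card_le1_eqP cw x y) ?xY.
Qed.
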